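(* Let $\alpha$ be a real number with $0<\alpha<1$. There exists a recurrent infinite word $u$ such that: 1. $P^w_u(n)=O(n^\alpha)$; 2. for infinitely many $n$, $P^w_u(n)\ge n^\alpha$.
   Context: An infinite word is a sequence $u=u_0u_1u_2\cdots$ of letters from a finite alphabet. It is recurrent if every factor (finite block of consecutive letters) of $u$ appears infinitely many times in $u$. The window complexity function of $u$ is $P^w_u(n)=\#\{u_{kn}u_{kn+1}\cdots u_{(k+1)n-1}: k\ge 0\}$. *)

(* Defs.v *)
From mathcomp Require Import all_boot all_order all_algebra.
From mathcomp Require Import all_classical all_reals all_analysis.
Import numFieldNormedType.Exports.

Set Implicit Arguments.
Unset Strict Implicit.
Unset Printing Implicit Defensive.

Local Open Scope classical_set_scope.

Definition word_factor (A : finType) (u : nat -> A) (i n : nat) : n.-tuple A :=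
  [tuple u (i + j) | j < n].

Definition recurrent (A : finType) (u : nat -> A) : Prop :=
  forall i n : nat, infinite_set [set j | word_factor u j n = word_factor u i n].

Definition window_complexity (A : finType) (u : nat -> A) (n : nat) : nat :=
  #|[set w : n.-tuple A | `[< exists k : nat, w = word_factor u (k * n) n >]]%SET|.

(* Main.v *)
Require Import Defs.
From mathcomp Require Import all_boot all_order all_algebra.
From mathcomp Require Import all_classical all_reals all_analysis.
From mathcomp Require Import zify lra.
Import Order.TTheory GRing.Theory Num.Theory numFieldNormedType.Exports.

(* The word is the indicator of the union of finite sets X_k, where X_0 = {0}
   and X_(k+1) is a union of m_k = floor(p_k^alpha) + 1 translates of X_k by the
   multiples of q_k = (p_k - 1)!, for a prime p_k exceeding the length of X_k.
   Every n < p_k divides q_k, so the grid of windows of length n sees all copies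
   of X_k in the same position.  For p_(k-1) <= n < p_k this leaves only the
   windows inside X_k, and those that are nonzero meet one of the m_(k-1) short
   copies of X_(k-1): there are O(n^alpha) of them.  At n = p_k, however, q_k is
   prime to n, so the m_k copies of X_k start at distinct residues modulo n and
   give m_k distinct windows. *)

Set Implicit Arguments.
Unset Strict Implicit.
Unset Printing Implicit Defensive.

Lemma infinite_nat_inj (f : nat -> nat) (S : set nat) :
  injective f -> (forall k, S (f k)) -> infinite_set S.
Proof.
move=> f_inj Sf finS; apply: infinite_nat.
apply: (sub_finite_set _ (finite_preimage (in2W f_inj) finS)) => k _.
exact: Sf.
Qed.

(** * Construction of the word *)

Section SparseWord.

Variable m : nat -> nat.
Hypothesis m_gt1 : forall n, 0 < n -> 1 < m n.
Hypothesis m_le : forall n, 1 < n -> m n <= n.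

(** The margin 4 gives (p-1)! >= l + p for the chosen prime p, which leaves at least p zeros between
    consecutive copies. *)
Definition prime_past (l : nat) : nat := s2val (prime_above (l + 4)).

Fixpoint len (k : nat) : nat :=
  if k is k'.+1 then let p := prime_past (len k') in m p * (p.-1)`! else 1.

Definition scale (k : nat) : nat := prime_past (len k).

Definition spacing (k : nat) : nat := ((scale k).-1)`!.

(** Indicator of X_k: the quotient by the spacing numbers the copy, the remainder is the position in
    it. *)
Fixpoint stage (k x : nat) : bool :=
  if k is k'.+1 then
    (x %/ spacing k' < m (scale k')) && stage k' (x %% spacing k')
  else x == 0.

(** The diagonal is enough: x < [spacing x], and below [spacing k] all later stages agree with
    [stage k]. *)
Definition limit_word (x : nat) : bool := stage x x.

(** * Growth and divisibility of the scales *)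

Lemma lenS k : len k.+1 = m (scale k) * spacing k.
Proof. by []. Qed.

Lemma scale_prime k : prime (scale k).
Proof. by rewrite /scale /prime_past; case: (prime_above _). Qed.

Lemma len_lt_scale k : len k + 4 < scale k.
Proof. by rewrite /scale /prime_past; case: (prime_above _). Qed.

Lemma spacing_ge k : len k + scale k <= spacing k.
Proof.
have := len_lt_scale k; rewrite /spacing.
case: (scale k) => [|[|[|[|n]]]] //=; try lia.
move=> h; rewrite factS; have : n.+2 <= n.+2`! by apply: fact_geq.
nia.
Qed.

Lemma spacing_gt0 k : 0 < spacing k. Proof. exact: fact_gt0. Qed.

Lemma m_scale_gt1 k : 1 < m (scale k).
Proof. by apply: m_gt1; have := len_lt_scale k; lia. Qed.

Lemma spacing_lt_len k : spacing k < len k.+1.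
Proof. by rewrite lenS; have := m_scale_gt1 k; have := spacing_gt0 k; nia. Qed.

Lemma spacing_ltS k : spacing k < spacing k.+1.
Proof. by have := spacing_ge k.+1; have := spacing_lt_len k; lia. Qed.

Lemma scale_ltS k : scale k < scale k.+1.
Proof.
by have := len_lt_scale k.+1; have := spacing_lt_len k;
  have := spacing_ge k; lia.
Qed.

Lemma scale_inj : injective scale.
Proof. exact: (incn_inj (leq_mono (homo_ltn ltn_trans scale_ltS))). Qed.

Lemma spacing_inj : injective spacing.
Proof. exact: (incn_inj (leq_mono (homo_ltn ltn_trans spacing_ltS))). Qed.

Lemma spacing_dvd k j : k <= j -> spacing k %| spacing j.
Proof.
move=> kj; have le : scale k <= scale j.
  by rewrite (leq_mono (homo_ltn ltn_trans scale_ltS)).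
rewrite /spacing -(@bin_fact (scale j).-1 (scale k).-1); last by lia.
by rewrite dvdn_mull // dvdn_mulr.
Qed.

Lemma lt_scale k : k < scale k.
Proof.
elim: k => [|k IH]; first by have := len_lt_scale 0; lia.
by have := scale_ltS k; lia.
Qed.

Lemma lt_spacing k : k < spacing k.
Proof. by have := lt_scale k; have := spacing_ge k; lia. Qed.

(** * Block structure of the word *)

Lemma stage_small k x : stage k x -> x < len k.
Proof.
case: k => [/eqP -> //|k /andP[h _]].
by rewrite lenS -ltn_divLR ?spacing_gt0.
Qed.

Lemma stage_stable k j x : k <= j -> x < spacing k -> stage j x = stage k x.
Proof.
move=> kj xk; elim: j kj => [|j IH]; first by rewrite leqn0 => /eqP ->.
rewrite leq_eqVlt ltnS => /predU1P[-> //|kj].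
have xj : x < spacing j.
  by apply: leq_trans xk _; apply: dvdn_leq (spacing_gt0 _) (spacing_dvd kj).
by rewrite /= divn_small // modn_small // IH // (ltnW (m_scale_gt1 j)).
Qed.

Lemma limit_word_stage k x : x < spacing k -> limit_word x = stage k x.
Proof.
move=> xk; rewrite /limit_word; case: (leqP x k) => h.
  by rewrite (stage_stable h) // lt_spacing.
by rewrite (stage_stable (ltnW h)).
Qed.

Lemma limit_word_copy k b y : b < m (scale k) -> y < spacing k ->
  limit_word (b * spacing k + y) = stage k y.
Proof.
move=> bm yk; rewrite (@limit_word_stage k.+1) /=; last first.
  have := spacing_ge k.+1; rewrite lenS; nia.
by rewrite divnMDl ?spacing_gt0 // modnMDl divn_small // modn_small // addn0 bm.
Qed.

(** As [spacing k] divides [spacing j], a block of length [spacing k] never straddles two copies of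
    X_j, so the dichotomy passes from j to j+1. *)
Lemma stage_block k j b : k <= j ->
  (forall y, y < spacing k -> stage j (b * spacing k + y) = stage k y) \/
  (forall y, y < spacing k -> stage j (b * spacing k + y) = false).
Proof.
move=> kj; elim: j b kj => [|j IH] b.
  rewrite leqn0 => /eqP ->; case: b => [|b]; [left|right] => y hy //=.
  by apply/eqP; have := spacing_gt0 0; nia.
rewrite leq_eqVlt ltnS => /predU1P[->|kj].
  case: b => [|b]; [by left|right] => y hy.
  apply/negP => /stage_small; have := spacing_ge j.+1; nia.
have /dvdnP[d dE] := spacing_dvd kj.
have d0 : 0 < d by have := spacing_gt0 j; rewrite dE; case: d {dE}.
have split_pos y : y < spacing k -> b * spacing k + y =
    b %/ d * spacing j + (b %% d * spacing k + y).
  by move=> _; rewrite {1}(divn_eq b d) dE; lia.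
have lt_pos y : y < spacing k -> b %% d * spacing k + y < spacing j.
  by move=> hy; rewrite dE; have := ltn_pmod b d0; nia.
have stageE y : y < spacing k -> stage j.+1 (b * spacing k + y) =
    (b %/ d < m (scale j)) && stage j (b %% d * spacing k + y).
  move=> hy; rewrite split_pos //= divnMDl ?spacing_gt0 //.
  by rewrite modnMDl (divn_small (lt_pos y hy)) (modn_small (lt_pos y hy)) addn0.
case: (boolP (b %/ d < m (scale j))) => bm; last first.
  by right => y hy; rewrite stageE // (negPf bm).
by case: (IH (b %% d) kj) => h; [left|right] => y hy; rewrite stageE // bm h.
Qed.

Lemma limit_word_block k b :
  (forall y, y < spacing k -> limit_word (b * spacing k + y) = stage k y) \/
  (forall y, y < spacing k -> limit_word (b * spacing k + y) = false).
Proof.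
(* Large enough that the whole block lies below [spacing j]. *)
pose j := b.+1 * spacing k + k.
have E y : y < spacing k ->
    limit_word (b * spacing k + y) = stage j (b * spacing k + y).
  by move=> hy; apply: limit_word_stage; have := lt_spacing j; rewrite {1}/j; lia.
by case: (@stage_block k j b) => [|h|h]; rewrite ?leq_addl //;
  [left|right] => y hy; rewrite E // h.
Qed.

(** * Upper bound on the window complexity *)

Lemma spacing_dvd_small k n : 0 < n -> n < scale k -> n %| spacing k.
Proof. by move=> n0 nk; apply: dvdn_fact; lia. Qed.

Definition stage_factor k n i : n.-tuple bool :=
  [tuple stage k.+1 (i * n + j) | j < n].

(* Windows of length [n] are aligned with the copies of [stage k.+1], and each
   copy of [stage k] therein, being shorter than [n], meets at most two. *)
Lemma window_complexity_le k n : scale k <= n < scale k.+1 ->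
  window_complexity limit_word n <= (m (scale k)).*2.+1.
Proof.
move=> /andP[kn nk].
have n0 : 0 < n by have := len_lt_scale k; lia.
(* [None] codes the zero window; (j, e) codes the window holding the start of copy j, or the next
   one if e is true. *)
pose f (o : option ('I_(m (scale k)) * bool)) : n.-tuple bool :=
  if o is Some (j, e) then stage_factor k n (j * spacing k %/ n + e)
  else [tuple false | _ < n].
rewrite /window_complexity.
apply: (@leq_trans #|[set f o | o : option ('I_(m (scale k)) * bool)]%SET|); last first.
  apply: leq_trans (leq_imset_card _ _) _.
  by rewrite card_option card_prod card_ord card_bool muln2.
apply/subset_leq_card/fintype.subsetP => w; rewrite inE => /asboolP[i ->].
have /dvdnP[d dE] := spacing_dvd_small n0 nk.
have d0 : 0 < d by have := spacing_gt0 k.+1; rewrite dE; case: d {dE}.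
have posE j : i * n + j = i %/ d * spacing k.+1 + (i %% d * n + j).
  by rewrite {1}(divn_eq i d) dE; lia.
have pos_lt (j : 'I_n) : i %% d * n + j < spacing k.+1.
  by rewrite dE; have := ltn_pmod i d0; have := ltn_ord j; nia.
have zero_case : (forall j : 'I_n, limit_word (i * n + j) = false) ->
    word_factor limit_word (i * n) n
      \in [set f o | o : option ('I_(m (scale k)) * bool)]%SET.
  move=> h; apply/imsetP; exists None => //.
  by apply: eq_from_tnth => j; rewrite !tnth_mktuple h.
case: (limit_word_block k.+1 (i %/ d)) => h; last first.
  by apply: zero_case => j; rewrite posE h.
have [[j hj]|none] := pselect (exists j : 'I_n, limit_word (i * n + j)); last first.
  by apply: zero_case => j; apply/negP => hj; apply: none; exists j.
move: hj; rewrite posE h // => sj.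
have := sj; rewrite /= => /andP[bm].
set b := _ %/ spacing k in bm; move/stage_small => hlen.
have /esym bE : b * spacing k + (i %% d * n + j) %% spacing k = i %% d * n + j.
  by rewrite -divn_eq.
(* The 1 found in the window lies less than [len k] < n after the start of copy b. *)
have eE : exists e : bool, i %% d = b * spacing k %/ n + e.
  have := divn_eq (b * spacing k) n; have := ltn_pmod (b * spacing k) n0.
  have := len_lt_scale k; have := ltn_ord j.
  set Q := _ %/ n; set r := _ %% n => h1 h2 h3 h4.
  have Q1 : Q <= i %% d by nia.
  have Q2 : i %% d <= Q.+1 by nia.
  exists (i %% d != Q); case: eqP => h5 /=; lia.
case: eE => e eE; apply/imsetP; exists (Some (Ordinal bm, e)) => //.
apply: eq_from_tnth => l.
by rewrite tnth_mktuple [RHS]tnth_mktuple /= posE h // -eE.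
Qed.

(** * Lower bound at the primes [scale k] *)

Lemma limit_word_copy_start k b : b < m (scale k) -> limit_word (b * spacing k).
Proof.
move=> bm; rewrite -[b * _]addn0 limit_word_copy ?spacing_gt0 //.
by elim: {bm}k => //= k IH; rewrite div0n mod0n IH (ltnW (m_scale_gt1 k)).
Qed.

(** The last [scale k] places of each block of length [spacing k] lie beyond X_k, by
    [spacing_ge]. *)
Lemma limit_word_gap k b x : x < b * spacing k -> b * spacing k - x < scale k ->
  limit_word x = false.
Proof.
case: b => [|b] // xb gap.
have ge := spacing_ge k.
have -> : x = b * spacing k + (x - b * spacing k) by lia.
have lt : x - b * spacing k < spacing k by lia.
have st : stage k (x - b * spacing k) = false.
  by apply/negP => /stage_small; lia.
by case: (limit_word_block k b) => ->.
Qed.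

(* The copies of [stage k] start at the multiples of [spacing k], which have
   distinct residues modulo the prime [scale k]. *)
Lemma window_complexity_ge k :
  m (scale k) <= window_complexity limit_word (scale k).
Proof.
set n := scale k; set q := spacing k.
have n_pr : prime n := scale_prime k; have n0 := prime_gt0 n_pr.
pose f (b : 'I_(m n)) := word_factor limit_word (b * q %/ n * n) n.
(* Were the residue of c smaller, the place where window c has the start of copy c would, in window
   b, fall in the zero gap before copy b. *)
have offset (b c : 'I_(m n)) : f b = f c -> b * q %% n <= c * q %% n.
  move=> bc; rewrite leqNgt; apply/negP => lt.
  have := congr1 (fun t => tnth t (Ordinal (ltn_pmod (c * q) n0))) bc.
  rewrite !tnth_mktuple /= -divn_eq limit_word_copy_start //.
  have := divn_eq (b * q) n; have := ltn_pmod (b * q) n0 => h1 h2.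
  by rewrite (@limit_word_gap k b) // -/q -/n; lia.
have f_inj : injective f.
  move=> b c bc; apply/val_inj => /=.
  have : b * q %% n = c * q %% n.
    by apply/eqP; rewrite eqn_leq !offset.
  (* By Wilson n divides q + 1, hence not q. *)
  have cop : coprime n q.
    rewrite prime_coprime //; apply/negP => nq.
    have := n_pr; rewrite Wilson ?prime_gt1 // -/(spacing k) -addn1.
    by rewrite dvdn_addr // dvdn1 => /eqP n1; have := prime_gt1 n_pr; rewrite n1.
  have lt_n (a : 'I_(m n)) : a < n.
    by apply: leq_trans (ltn_ord a) _; apply: m_le; apply: prime_gt1.
  case: (leqP b c) => [le|/ltnW le]; last first.
    move/eqP; rewrite eqn_mod_dvd ?leq_mul // -mulnBl Gauss_dvdl //.
    by rewrite -eqn_mod_dvd // !modn_small // => /eqP.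
  move/esym/eqP; rewrite eqn_mod_dvd ?leq_mul // -mulnBl Gauss_dvdl //.
  by rewrite -eqn_mod_dvd // !modn_small // => /eqP.
rewrite -[leqLHS]card_ord -(card_imset _ f_inj).
apply/subset_leq_card/fintype.subsetP => w /imsetP[b _ ->].
by rewrite inE; apply/asboolP; exists (b * q %/ n).
Qed.

(** * Recurrence, and bracketing of n between scales *)

Lemma limit_word_recurrent : recurrent limit_word.
Proof.
(* For each K >= i + n, copy number 1 of X_K repeats the prefix of length [spacing K], which
   contains the factor. *)
move=> i n; apply: (@infinite_nat_inj (fun k => spacing (k + (i + n)) + i)).
  by move=> k l /addIn /spacing_inj /addIn.
move=> k /=; apply: eq_from_tnth => j; rewrite !tnth_mktuple.
set K := k + (i + n).
have lt : i + j < spacing K.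
  by apply: leq_ltn_trans (lt_spacing K); have := ltn_ord j; lia.
rewrite -addnA -{1}[spacing K]mul1n limit_word_copy ?m_scale_gt1 //.
by rewrite (limit_word_stage lt).
Qed.

Lemma scale_bracket n : scale 0 <= n ->
  exists k, scale k <= n < scale k.+1.
Proof.
move=> n0; case: (@ex_minnP (fun k => n < scale k)) => [|[|k] nk min].
- by exists n; apply: lt_scale.
- by rewrite ltnNge n0 in nk.
by exists k; rewrite nk andbT leqNgt; apply/negP => /min; rewrite ltnn.
Qed.

End SparseWord.

(** * Choice of [m] and conclusion *)

Local Open Scope classical_set_scope.
Local Open Scope ring_scope.

Theorem theorem8p1 (R : realType) (alpha : R) (halpha : 0 < alpha < 1) :
  exists (A : finType) (u : nat -> A),
    [/\ recurrent u,
        (fun n : nat => (window_complexity u n)%:R : R)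
          =O_\oo (fun n : nat => n%:R `^ alpha : R)
      & infinite_set
          [set n : nat | n%:R `^ alpha <= (window_complexity u n)%:R :> R]].
Proof.
have /andP[a0 a1] := halpha.
pose m (n : nat) := (Num.truncn (n%:R `^ alpha : R)).+1.
have pow_ge1 n : (0 < n)%N -> 1 <= n%:R `^ alpha :> R.
  by move=> n0; rewrite -[leLHS](powRr0 n%:R) ler_powR ?ler1n // ltW.
have m_gt1 n : (0 < n)%N -> (1 < m n)%N.
  by move=> n0; rewrite /m ltnS truncn_gt0 pow_ge1.
have m_le n : (1 < n)%N -> (m n <= n)%N.
  move=> n1; rewrite /m truncn_lt_nat ?powR_ge0 //.
  rewrite -[ltRHS]powRr1 ?ler0n // /powR gt_eqF ?ltr0n ?(ltnW n1) //.
  by rewrite ltr_expR ltr_pM2r // ln_gt0 // ltr1n.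
exists bool, (limit_word m); split.
- exact: limit_word_recurrent.
(* With p = [scale m k] <= n, the bound 2 [m p] + 1 is at most 2 p^alpha + 3 <= 5 n^alpha, as
   n^alpha >= 1. *)
- apply/eqO_exP; exists 5 => //; exists (scale m 0) => // n /= n0.
  have [k /andP[kn nk]] := scale_bracket m_gt1 n0.
  have n_gt0 : (0 < n)%N by have := lt_scale m_gt1 k; lia.
  rewrite ger0_norm // ger0_norm ?powR_ge0 //.
  apply: (@le_trans _ _ ((m (scale m k)).*2.+1)%:R).
    by rewrite ler_nat window_complexity_le // kn.
  have le_pow : (scale m k)%:R `^ alpha <= n%:R `^ alpha :> R.
    by rewrite ge0_ler_powR ?nnegrE ?ler_nat // ltW.
  have ge1 := pow_ge1 n n_gt0.
  have := truncn_le ((scale m k)%:R `^ alpha : R).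
  rewrite powR_ge0 /m -mul2n -natr1 natrM -[X in 2 * X]natr1.
  lra.
- apply: (@infinite_nat_inj (scale m)) => [|k /=]; first exact: scale_inj.
  apply: le_trans (ltW (truncnS_gt _)) _.
  by rewrite ler_nat window_complexity_ge.
Qed.
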